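(* Let $\ell_1,\ell_2\in\mathbb{N}\setminus\{1\}$ be relatively prime, and let $p(x,y):=x^{\ell_1}-y^{\ell_2}$. Then, for every $n\ge\max\{\ell_1,\ell_2\}$, there exists a truncated sequence $\beta^{(2n)}$ having the $k$-extension property relative to $\{1,p,-p\}$ for every $k\in\mathbb{N}$, but admitting no $\mathcal{Z}_p$-representing measure. Consequently, $\{1,p,-p\}$ does not satisfy property $(S_{n,k})$ for any $k\in\mathbb{N}_0$.
   Context: Here $\mathbb{N}=\{1,2,\ldots\}$, $\mathbb{N}_0=\mathbb{N}\cup\{0\}$, $\mathcal{P}_m=\{f\in\mathbb{R}[x,y]:\deg f\le m\}$, and $\mathcal{Z}_p=\{(x,y)\in\mathbb{R}^2:p(x,y)=0\}$. A truncated (bivariate) sequence of degree $2n$ is a family of real numbers $\beta\equiv\beta^{(2n)}=\{\beta_{i,j}\}_{i,j\in\mathbb{N}_0,\,i+j\le 2n}$. Its Riesz functional is the linear map $L_\beta:\mathcal{P}_{2n}\to\mathbb{R}$ with $L_\beta(x^iy^j)=\beta_{i,j}$. Let $\mathcal{B}_m$ denote the set of monomials of degree at most $m$. The moment matrix $M(n)\equiv M(n;\beta)$ is the symmetric matrix indexed by $\mathcal{B}_n\times\mathcal{B}_n$ whose entry at monomials $(u,v)$ is $L_\beta(uv)$. For a polynomial $q$ of degree $\delta\le 2n$, the localizing matrix $M_q(n)\equiv M_q(n;\beta)$ is the symmetric matrix indexed by $\mathcal{B}_{n-\lceil\delta/2\rceil}\times\mathcal{B}_{n-\lceil\delta/2\rceil}$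 whose entry at $(u,v)$ is $L_\beta(quv)$. For $k\in\mathbb{N}_0$, a positive extension of $M(n)$ of order $n+k$ is a moment matrix $M(n+k)\succeq 0$ (of some truncated sequence of degree $2(n+k)$) whose principal submatrix indexed by $\mathcal{B}_n$ equals $M(n)$. Let $Q=\{q_0:=1,q_1,\ldots,q_m\}\subset\mathbb{R}[x,y]$ and $K_Q=\{z\in\mathbb{R}^2:q_i(z)\ge 0,\ i=0,\ldots,m\}$. A $K$-representing measure for $\beta^{(2n)}$ is a positive Borel measure $\mu$ on $\mathbb{R}^2$ supported on $K$ with $\beta_{i,j}=\int x^iy^j\,d\mu$ for all $i+j\le 2n$. The sequence $\beta^{(2n)}$ has the $k$-extension property relative to $Q$ if $M(n)$ admits a positive extension $M(n+k)$ such that $M_{q_i}(n+k)\succeq 0$ for $i=1,\ldots,m$. The family $Q$ satisfies property $(S_{n,k})$ if, for every truncated sequence $\beta^{(2n)}$ of degree $2n$: $\beta^{(2n)}$ has a $K_Q$-representing measure if and only if $\beta^{(2n)}$ has the $k$-extension property relative to $Q$. For $Q=\{1,p,-p\}$ one has $K_Q=\mathcal{Z}_p$. *)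

(* Defs.v *)
From HB Require Import structures.
From mathcomp Require Import all_boot all_order all_algebra.
(* The notations of mpoly are incompatible with those of mathcomp-analysis. *)
From mathcomp Require Import -(notations) mpoly.
From mathcomp Require Import all_classical all_reals all_analysis.

Set Implicit Arguments.
Unset Strict Implicit.
Unset Printing Implicit Defensive.

Import Order.TTheory GRing.Theory Num.Theory.
Import numFieldNormedType.Exports.

Local Open Scope classical_set_scope.
Local Open Scope ring_scope.

(* The monomial x^i y^j is the multinomial m : multinom 2 with m ord0 = i and
   m ord_max = j, so that [monomials d] is the set of monomials of degree at
   most d. *)
Notation monomials d := (bmultinom 2 d.+1).

Definition coordX (R : realType) : mpoly 2 R := mpolyX R (mnm1 ord0).
Definition coordY (R : realType) : mpoly 2 R := mpolyX R (mnm1 ord_max).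

Definition peval (R : realType) (q : mpoly 2 R) (z : R * R) : R :=
  meval (fun i : 'I_2 => if i == ord0 then z.1 else z.2) q.

Definition pdeg (R : realType) (q : mpoly 2 R) : nat := (msize q).-1.

Definition zero_set (R : realType) (q : mpoly 2 R) : set (R * R) :=
  [set z | peval q z = 0].

Definition semialgebraic (R : realType) (Q : seq (mpoly 2 R)) : set (R * R) :=
  [set z | forall q, q \in Q -> 0 <= peval q z].

(* A truncated sequence of degree 2n. *)
Definition truncated_seq (R : realType) (n : nat) : Type :=
  monomials (2 * n) -> R.

(* On polynomials of degree at most 2n this is the Riesz functional; it is only
   meant to be applied to these (monomials of higher degree are sent to 0). *)
Definition riesz (R : realType) (n : nat) (beta : truncated_seq R n)
    (q : mpoly 2 R) : R :=
  \sum_(m : monomials (2 * n)) mcoeff m q * beta m.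

Definition moment_mx (R : realType) (n : nat) (beta : truncated_seq R n) :
    'M[R]_#|{: monomials n}| :=
  \matrix_(i, j)
    riesz beta (mpolyX R (enum_val i : monomials n)
                * mpolyX R (enum_val j : monomials n)).

(* [uphalf d] is the ceiling of d/2. The subtraction does not truncate when
   pdeg q <= 2n, which is required for the localizing matrix to make sense. *)
Definition localizing_order (R : realType) (n : nat) (q : mpoly 2 R) : nat :=
  n - uphalf (pdeg q).

Definition localizing_mx (R : realType) (n : nat) (beta : truncated_seq R n)
    (q : mpoly 2 R) : 'M[R]_#|{: monomials (localizing_order n q)}| :=
  \matrix_(i, j)
    riesz beta (q * mpolyX R (enum_val i : monomials (localizing_order n q))
                  * mpolyX R (enum_val j : monomials (localizing_order n q))).

Definition psd (R : realType) (N : nat) (A : 'M[R]_N) : Prop :=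
  A^T = A /\ forall v : 'cV[R]_N, 0 <= (v^T *m A *m v) ord0 ord0.

Lemma widen_monomial_proof (n k : nat) (m : monomials n) :
  (mdeg m < (n + k).+1)%N.
Proof. by rewrite ltnS (leq_trans _ (leq_addr k n)) // -ltnS bmdeg. Qed.

Definition widen_monomial (n k : nat) (m : monomials n) : monomials (n + k) :=
  BMultinom (widen_monomial_proof k m).

Definition widen_index (n k : nat) (i : 'I_#|{: monomials n}|) :
    'I_#|{: monomials (n + k)}| :=
  enum_rank (widen_monomial k (enum_val i)).

(* M(n+k; gamma) is a positive extension of M(n; beta). *)
Definition positive_extension (R : realType) (n k : nat)
    (beta : truncated_seq R n) (gamma : truncated_seq R (n + k)) : Prop :=
  psd (moment_mx gamma) /\
  mxsub (@widen_index n k) (@widen_index n k) (moment_mx gamma)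
    = moment_mx beta.

(* The family Q = {q_0, ..., q_m} is represented by the sequence
   [:: q_0; ...; q_m] with q_0 = 1, so that q_1, ..., q_m are the elements of
   [behead Q]. *)
Definition extension_property (R : realType) (n k : nat)
    (beta : truncated_seq R n) (Q : seq (mpoly 2 R)) : Prop :=
  exists gamma : truncated_seq R (n + k),
    positive_extension beta gamma /\
    forall q, q \in behead Q -> psd (localizing_mx gamma q).

(* The plane with its Borel sigma-algebra, generated by the open sets. *)
Definition borel_plane (R : realType) := g_sigma_algebraType (@open (R * R)%type).

Definition representing_measure (R : realType) (n : nat) (K : set (R * R))
    (beta : truncated_seq R n)
    (mu : {measure set (borel_plane R) -> \bar R}) : Prop :=
  mu.-negligible (~` K) /\
  forall m : monomials (2 * n),
    let f := fun z : borel_plane R => (z.1 ^+ m ord0 * z.2 ^+ m ord_max)%:E in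
    mu.-integrable setT f /\ (\int[mu]_z f z)%E = (beta m)%:E.

Definition has_representing_measure (R : realType) (n : nat)
    (K : set (R * R)) (beta : truncated_seq R n) : Prop :=
  exists mu : {measure set (borel_plane R) -> \bar R},
    representing_measure K beta mu.

Definition property_S (R : realType) (n k : nat) (Q : seq (mpoly 2 R)) : Prop :=
  forall beta : truncated_seq R n,
    has_representing_measure (semialgebraic Q) beta
    <-> extension_property k beta Q.

(* Main.v *)
Require Import Defs.
From HB Require Import structures.
From mathcomp Require Import all_boot all_order all_algebra.
From mathcomp Require Import -(notations) mpoly.
From mathcomp Require Import all_classical all_reals all_analysis.
From mathcomp Require Import zify ring lra.

(** The curve [x ^ l1 = y ^ l2] is parametrized by [x = t ^ l2, y = t ^ l1], so
    on it the monomial [x ^ i y ^ j] becomes [t ^ w] with weight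
    [w = l2 * i + l1 * j].  The weights form the numerical semigroup generated
    by [l1] and [l2], whose Frobenius number [g = l1 * l2 - l1 - l2] is a gap
    although [g.*2 = l2 * (l1 - 2) + l1 * (l2 - 2)] is the weight of
    [x ^ (l1 - 2) y ^ (l2 - 2)].  Thus [t ^ g.*2] is a nonnegative polynomial
    function on the curve whose square root [t ^ g] is not one, and a
    functional that is nonnegative on squares may still be negative on it.

    Such a functional is obtained by sending each monomial of weight [w] to
    [phi w], where [phi g.*2 = -1] and [phi m = 4 ^ (m ^ 2)] elsewhere.

    - It is nonnegative on squares in every degree
      ([punctured_graded_form_ge0]).  The numbers [4 ^ (m ^ 2)] are so strongly
      log-convex that, after normalizing the diagonal, the Hankel matrix
      [phi (s + t)] is diagonally dominant; the negative value sits on the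
      diagonal only at [s = t = g], an index that is not a weight.
    - It depends on the weight only, so it kills every multiple of
      [x ^ l1 - y ^ l2], and the localizing matrices of the curve and of its
      opposite vanish ([extension_property_weight_seq]).
    - It has no representing measure on the curve, because
      [x ^ (l1 - 2) y ^ (l2 - 2)] is nonnegative there
      ([monomial_ge0_on_curve]) and has moment [-1].

    The truncations of this single functional provide the extensions of all
    orders [k], including [k = 0], so property [S_(n, k)] always fails. *)

Import Order.TTheory GRing.Theory Num.Theory.

Local Open Scope ring_scope.

(** * A diagonally dominant Hankel form *)

(** The two geometric series add up to [5 / 3]; the exponent is the distance
    between [s] and [t], written with truncated subtractions. *)
Lemma sum_quarter_dist_le2 (R : realFieldType) (s N : nat) :
  \sum_(t < N) (4^-1 : R) ^+ ((s - t) + (t - s)) <= 2.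
Proof.
set F := fun M => \sum_(t < M) (4^-1 : R) ^+ ((s - t) + (t - s)).
(* Both partial bounds are exact up to the missing tails of the series, and
   they agree at [M = s], which makes the inductions go through. *)
have below M : (M <= s)%N -> F M <= 3^-1 * 4^-1 ^+ (s - M).
  elim: M => [_|M IH ltMs]; rewrite /F.
    by rewrite big_ord0 mulr_ge0 // exprn_ge0.
  rewrite big_ord_recr /=.
  have := IH (ltnW ltMs); rewrite /F.
  have -> : ((s - M) + (M - s) = (s - M.+1).+1)%N by lia.
  have -> : (s - M = (s - M.+1).+1)%N by lia.
  rewrite exprS.
  set r := _ ^+ _; lra.
have above k : F (s + k)%N <= 5 / 3 - 4 / 3 * 4^-1 ^+ k.
  elim: k => [|k IH]; rewrite /F.
    by have := below s (leqnn s); rewrite subnn addn0 !expr0 /F; lra.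
  rewrite addnS big_ord_recr /=.
  move: IH; rewrite /F.
  have -> : ((s - (s + k)) + (s + k - s) = k)%N by lia.
  rewrite exprS; set r := _ ^+ k; lra.
have quarter_le1 k : 0 <= (4^-1 : R) ^+ k <= 1.
  by rewrite exprn_ge0 //= exprn_ile1 // invf_le1 // ler1n.
rewrite -/(F N); case: (leqP N s) => [leNs|ltsN].
  have := below N leNs; have /andP[_] := quarter_le1 (s - N)%N.
  set r := _ ^+ _; lra.
have := above (N - s)%N; have /andP[+ _] := quarter_le1 (N - s)%N.
rewrite subnKC ?(ltnW ltsN) //.
set r := _ ^+ _; lra.
Qed.

(** The moments [4 ^ (m ^ 2)] of a log-normal distribution, made
    incompatible with any measure at the single index [g.*2]. *)
Definition punctured (R : realType) (g m : nat) : R :=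
  if m == g.*2 then -1 else 4 ^+ (m ^ 2).

(** Log-convexity: [(s + t) ^ 2 + (s - t) ^ 2 = 2 * s ^ 2 + 2 * t ^ 2], and
    [(s - t) ^ 2 >= `|s - t|] turns Gaussian decay into the geometric decay
    that is easy to sum. *)
Lemma punctured_norm_le (R : realType) (g s t : nat) :
  `|punctured R g (s + t)| <=
    4 ^+ (2 * s ^ 2) * 4 ^+ (2 * t ^ 2) * 4^-1 ^+ ((s - t) + (t - s)).
Proof.
have pow_ge1 m : 1 <= 4 ^+ m :> R by rewrite exprn_ege1 // ler1n.
apply: (@le_trans _ _ (4 ^+ ((s + t) ^ 2))).
  by rewrite /punctured; case: eqP => _; rewrite ?normrN1 ?ger0_norm ?exprn_ge0.
rewrite -exprD exprVn ler_pdivlMr ?exprn_gt0 // -exprD ler_weXn2l ?ler1n //.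
nia.
Qed.

(** Diagonal dominance.  In the normalized unknowns [b s] the diagonal entries
    are [1], except at [g] where the unknown vanishes, and the off-diagonal
    entries of a row sum to at most [1]. *)
Lemma punctured_form_ge0 (R : realType) (g N : nat) (u : nat -> R) :
  u g = 0 ->
  0 <= \sum_(s < N) \sum_(t < N) u s * u t * punctured R g (s + t).
Proof.
move=> ug0.
pose b s := u s * 4 ^+ (2 * s ^ 2).
pose c s t : R := 4^-1 ^+ ((s - t) + (t - s)).
have c_ge0 s t : 0 <= c s t by rewrite exprn_ge0.
have cC s t : c s t = c t s by rewrite /c addnC.
(* An off-diagonal term is bounded below by the inequality between arithmetic
   and geometric means; on the diagonal, where [c s s = 1], the same
   expression plus [2 * b s ^+ 2] is the exact value. *)
have entry_ge s t : (s == t)%:R * (2 * b s ^+ 2)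
    - (c s t * b s ^+ 2 / 2 + c s t * b t ^+ 2 / 2)
    <= u s * u t * punctured R g (s + t).
  case: eqP => [<-|_].
    rewrite /c subnn expr0 !mul1r.
    have [->|neq_sg] := eqVneq s g.
      by rewrite /b ug0; lra.
    rewrite /punctured addnn (inj_eq double_inj) (negPf neq_sg) /b.
    have -> : (s.*2 ^ 2 = 2 * s ^ 2 + 2 * s ^ 2)%N by lia.
    by rewrite exprD; lra.
  rewrite mul0r sub0r.
  have : `|u s * u t * punctured R g (s + t)| <= c s t * (`|b s| * `|b t|).
    rewrite !normrM.
    apply: le_trans (ler_wpM2l _ (punctured_norm_le R g s t)) _.
      by rewrite mulr_ge0.
    by rewrite !(ger0_norm (exprn_ge0 _ _)) // -/(c s t); lra.
  rewrite ler_norml => /andP[+ _]; apply: le_trans.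
  rewrite -mulrDl -mulrDr -mulrA lerN2 ler_wpM2l //.
  rewrite -(real_normK (num_real (b s))) -(real_normK (num_real (b t))).
  have := sqr_ge0 (`|b s| - `|b t|); rewrite sqrrB; lra.
apply: (@le_trans _ _ (\sum_(s < N) \sum_(t < N) ((val s == val t)%:R
    * (2 * b s ^+ 2) - (c s t * b s ^+ 2 / 2 + c s t * b t ^+ 2 / 2)))); last first.
  by apply: ler_sum => s _; apply: ler_sum => t _; exact: entry_ge.
have -> : \sum_(s < N) \sum_(t < N) ((val s == val t)%:R * (2 * b s ^+ 2)
    - (c s t * b s ^+ 2 / 2 + c s t * b t ^+ 2 / 2))
  = \sum_(s < N) (2 - \sum_(t < N) c s t) * b s ^+ 2.
  have diag (s : 'I_N) :
      \sum_(t < N) (val s == val t)%:R * (2 * b s ^+ 2) = 2 * b s ^+ 2.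
    rewrite (bigD1 s) //= eqxx mul1r big1 ?addr0 // => t.
    by rewrite eq_sym => /negPf neq; rewrite (_ : (val s == val t) = false) ?mul0r.
  under eq_bigr => s _ do rewrite sumrB diag big_split /=.
  rewrite sumrB big_split /= [X in _ - (_ + X)]exchange_big /=.
  rewrite -big_split /= -sumrB; apply: eq_bigr => s _.
  under [X in _ - (_ + X)]eq_bigr => t _ do rewrite cC.
  by rewrite -!mulr_suml; lra.
apply: sumr_ge0 => s _; rewrite mulr_ge0 ?sqr_ge0 // subr_ge0.
exact: sum_quarter_dist_le2.
Qed.

(** Several indices may share a weight: gathering them reduces to the form
    indexed by the weights, with no contribution at [g]. *)
Lemma punctured_graded_form_ge0 (R : realType) (g : nat) (I : finType)
    (w : I -> nat) (v : I -> R) :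
  (forall i, w i != g) ->
  0 <= \sum_i \sum_j v i * v j * punctured R g (w i + w j).
Proof.
move=> wNg; pose N := (\max_i w i).+1.
have w_lt i : (w i < N)%N by rewrite ltnS (leq_bigmax_cond (F := w)).
pose wN i : 'I_N := Ordinal (w_lt i).
pose u s := \sum_(i | w i == s) v i.
have -> : \sum_i \sum_j v i * v j * punctured R g (w i + w j) =
    \sum_(s < N) \sum_(t < N) u s * u t * punctured R g (s + t).
  rewrite (partition_big wN xpredT) //=; apply: eq_bigr => s _.
  under eq_bigr => i _ do rewrite (partition_big wN xpredT) //=.
  rewrite exchange_big /=; apply: eq_bigr => t _.
  rewrite /u !mulr_suml; apply: eq_big => [i|i /eqP <-]; first by [].
  rewrite mulr_sumr mulr_suml.
  by apply: eq_big => [j|j /eqP <-].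
apply: punctured_form_ge0; rewrite /u big_pred0 // => i.
exact: negbTE.
Qed.

(** * Weights of monomials *)

(** The exponent of [t] in [x ^ m0 y ^ m1] for [x = t ^ l2], [y = t ^ l1]. *)
Definition weight (l1 l2 : nat) (m : multinom 2) : nat :=
  (l2 * m ord0 + l1 * m ord_max)%N.

Lemma weightD (l1 l2 : nat) (m1 m2 : multinom 2) :
  weight l1 l2 (mnm_add m1 m2) = (weight l1 l2 m1 + weight l1 l2 m2)%N.
Proof. by rewrite /weight !mnmDE; ring. Qed.

(** If [g] were a weight, then [l2 * i.+1 + l1 * j.+1 = l1 * l2]; by coprimality
    [l1] divides [i.+1], so the first term alone exhausts the right-hand
    side. *)
Lemma weight_neq_frobenius (l1 l2 : nat) (m : multinom 2) :
  (1 < l1)%N -> (1 < l2)%N -> coprime l1 l2 ->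
  weight l1 l2 m != (l1 * l2 - l1 - l2)%N.
Proof.
move=> hl1 hl2 hco; apply/eqP; rewrite /weight.
move: (m ord0) (m ord_max) => i j eq_g.
have eq_prod : (l2 * i.+1 + l1 * j.+1 = l1 * l2)%N by nia.
have /dvdnP[a ia] : (l1 %| i.+1)%N.
  rewrite -(Gauss_dvdr _ hco) -(dvdn_addl _ (dvdn_mulr j.+1 (dvdnn l1))).
  by rewrite eq_prod dvdn_mulr.
have : (0 < a)%N by lia.
nia.
Qed.

(** * Sequences that depend on the weight only *)

Definition weight_seq (R : realType) (l1 l2 : nat) (phi : nat -> R) (n : nat) :
  truncated_seq R n := fun m => phi (weight l1 l2 m).

Lemma rieszB (R : realType) (n : nat) (beta : truncated_seq R n)
    (q r : mpoly 2 R) :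
  riesz beta (q - r) = riesz beta q - riesz beta r.
Proof.
by rewrite /riesz -sumrB; apply: eq_bigr => m _; rewrite mcoeffB mulrBl.
Qed.

Lemma riesz_weight_seqX (R : realType) (l1 l2 n : nat) (phi : nat -> R)
    (m : multinom 2) :
  (mdeg m <= 2 * n)%N ->
  riesz (weight_seq R l1 l2 phi n) (mpolyX R m) = phi (weight l1 l2 m).
Proof.
move=> le_m; have lt_m : (mdeg m < (2 * n).+1)%N by [].
rewrite /riesz (bigD1 (BMultinom lt_m)) //= mcoeffX eqxx mul1r big1 ?addr0 //.
move=> k neq_k; rewrite mcoeffX eq_sym.
by rewrite (_ : (bmnm k == m) = false) ?mul0r //; apply: negPf.
Qed.

(** * The moment problem on the curve *)

Definition binomial_curve (R : realType) (l1 l2 : nat) : mpoly 2 R :=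
  coordX R ^+ l1 - coordY R ^+ l2.

Lemma binomial_curveE (R : realType) (l1 l2 : nat) :
  binomial_curve R l1 l2 =
    mpolyX R (mnm_muln (mnm1 ord0) l1) - mpolyX R (mnm_muln (mnm1 ord_max) l2).
Proof. by rewrite /binomial_curve /coordX /coordY !mpolyXn. Qed.

(** A smaller degree would allow products [p * u * v] of degree above the
    truncation in the localizing matrix. *)
Lemma max_le_pdeg_binomial_curve (R : realType) (l1 l2 : nat) :
  (0 < l1)%N -> (0 < l2)%N ->
  (maxn l1 l2 <= pdeg (binomial_curve R l1 l2))%N.
Proof.
move=> hl1 hl2; rewrite /pdeg binomial_curveE.
set a := mnm_muln _ l1; set b := mnm_muln _ l2.
have ab : (a == b) = false.
  apply/negP => /eqP/mnmP/(_ ord0); rewrite !mulmnE !mnm1E /=; lia.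
have mdega : mdeg a = l1 by rewrite mdegMn mdeg1 mul1n.
have mdegb : mdeg b = l2 by rewrite mdegMn mdeg1 mul1n.
set q := _ - _.
have qa : a \in msupp q.
  by rewrite mcoeff_msupp mcoeffB !mcoeffX eqxx (eq_sym b) ab subr0 oner_neq0.
have qb : b \in msupp q.
  by rewrite mcoeff_msupp mcoeffB !mcoeffX eqxx ab sub0r oppr_eq0 oner_neq0.
have := msize_mdeg_lt qa; have := msize_mdeg_lt qb; rewrite mdega mdegb; lia.
Qed.

Lemma psd0 (R : realType) (N : nat) : psd (0 : 'M[R]_N).
Proof. by split=> [|v]; rewrite ?trmx0 // mulmx0 mul0mx mxE. Qed.

(** The row and column monomials have degree at most [n - uphalf d], so the
    products with [q] that occur never leave the truncation: this is where a
    lower bound on the degree of [q] is used. *)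
Lemma psd_localizing_eq0 (R : realType) (n d : nat) (beta : truncated_seq R n)
    (q : mpoly 2 R) :
  (d <= n)%N -> (d <= pdeg q)%N ->
  (forall m : multinom 2, (d + mdeg m <= 2 * n)%N ->
     riesz beta (q * mpolyX R m) = 0) ->
  psd (localizing_mx beta q).
Proof.
move=> le_dn le_dq riesz0.
suff -> : localizing_mx beta q = 0 by exact: psd0.
apply/matrixP => i j; rewrite !mxE -mulrA -mpolyXD riesz0 // mdegD.
have deg_half (k : 'I_#|{: monomials (localizing_order n q)}|) :
    (mdeg (bmnm (enum_val k)) <= n - uphalf d)%N.
  by rewrite -ltnS (leq_trans (bmdeg _)) // ltnS leq_sub2l // uphalf_leq.
move: (mdeg _) (mdeg _) (deg_half i) (deg_half j) => a b.
have := odd_double_half d; rewrite uphalf_half; lia.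
Qed.

(** Both terms of the curve have weight [l1 * l2], so their multiples by a
    monomial have the same image under the functional. *)
Lemma riesz_binomial_curve (R : realType) (l1 l2 n : nat) (phi : nat -> R)
    (m : multinom 2) :
  (maxn l1 l2 + mdeg m <= 2 * n)%N ->
  riesz (weight_seq R l1 l2 phi n) (binomial_curve R l1 l2 * mpolyX R m) = 0.
Proof.
move=> le_deg.
rewrite binomial_curveE mulrBl -!mpolyXD rieszB !riesz_weight_seqX.
- apply/eqP; rewrite subr_eq0 !weightD /weight !mulmnE !mnm1E /=.
  by apply/eqP; congr (phi _); ring.
- by rewrite mdegD mdegMn mdeg1 mul1n; lia.
- by rewrite mdegD mdegMn mdeg1 mul1n; lia.
Qed.

Lemma pdegN (R : realType) (q : mpoly 2 R) : pdeg (- q) = pdeg q.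
Proof. by rewrite /pdeg !mmeasureE (perm_big _ (msuppN q)). Qed.

(** The extension of order [k] is the sequence given by the same [phi] in degree
    [2 * (n + k)]: positivity of its moment matrix is the assumption on [phi],
    and its localizing matrices vanish. *)
Lemma extension_property_weight_seq (R : realType) (l1 l2 n : nat)
    (phi : nat -> R) :
  (0 < l1)%N -> (0 < l2)%N -> (maxn l1 l2 <= n)%N ->
  (forall (I : finType) (f : I -> multinom 2) (v : I -> R),
     0 <= \sum_i \sum_j
            v i * v j * phi (weight l1 l2 (f i) + weight l1 l2 (f j))%N) ->
  forall k : nat,
  extension_property k (weight_seq R l1 l2 phi n)
    [:: 1; binomial_curve R l1 l2; - binomial_curve R l1 l2].
Proof.
move=> hl1 hl2 le_n phi_ge0 k.
have momentE N (a b : monomials N) :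
    riesz (weight_seq R l1 l2 phi N) (mpolyX R a * mpolyX R b) =
    phi (weight l1 l2 a + weight l1 l2 b)%N.
  rewrite -mpolyXD riesz_weight_seqX ?weightD // mdegD.
  have := bmdeg a; have := bmdeg b; rewrite !ltnS; lia.
exists (weight_seq R l1 l2 phi (n + k)); split; first split.
- split; first by apply/matrixP => i j; rewrite !mxE mulrC.
  move=> v; rewrite mxE.
  have := phi_ge0 _ (fun i => bmnm (enum_val i)) (fun i => v i ord0).
  congr (0 <= _); rewrite exchange_big /=; apply: eq_bigr => j _.
  rewrite mxE mulr_suml; apply: eq_bigr => i _.
  by rewrite !mxE momentE mulrAC.
- apply/matrixP => i j; rewrite !mxE /widen_index !enum_rankK.
  by rewrite !momentE.
have le_nk : (maxn l1 l2 <= n + k)%N by lia.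
have degp := max_le_pdeg_binomial_curve R l1 l2 hl1 hl2.
move=> q; rewrite /= !inE => /orP[] /eqP ->.
- apply: (psd_localizing_eq0 _ _ _ _ _ le_nk degp) => m; exact: riesz_binomial_curve.
- apply: (psd_localizing_eq0 _ _ _ _ _ le_nk) => [|m le_m]; first by rewrite pdegN.
  rewrite -[X in X * _]sub0r mulrBl mul0r rieszB riesz_binomial_curve // subr0.
  by rewrite /riesz big1 // => a _; rewrite mcoeff0 mul0r.
Qed.

Lemma zero_set_binomial_curve (R : realType) (l1 l2 : nat) (z : R * R) :
  zero_set (binomial_curve R l1 l2) z -> z.1 ^+ l1 = z.2 ^+ l2.
Proof.
rewrite /zero_set /= /peval /binomial_curve mevalB !rmorphXn /= !mevalXU /=.
by move/eqP; rewrite subr_eq0 => /eqP.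
Qed.

Lemma semialgebraic_pm (R : realType) (p : mpoly 2 R) :
  semialgebraic [:: 1; p; - p] = zero_set p.
Proof.
apply/seteqP; split => z /=.
  move=> h; apply/eqP; rewrite eq_le; apply/andP; split.
    have := h (- p); rewrite !inE eqxx !orbT /peval mevalN oppr_ge0; exact.
  by have := h p; rewrite !inE eqxx !orbT; exact.
move=> h q; rewrite !inE => /or3P[] /eqP ->; rewrite /peval.
- by rewrite meval1.
- by rewrite -/(peval p z) h.
- by rewrite mevalN -/(peval p z) h oppr0.
Qed.

(** With [x = t ^ l2] and [y = t ^ l1] the value is [t ^ g.*2].  To avoid
    constructing [t], raise the monomial to an odd power, [l1] or [l2], which
    preserves its sign and makes it an even power of [y] or [x]. *)
Lemma monomial_ge0_on_curve (R : realType) (l1 l2 g i j : nat) (x y : R) :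
  coprime l1 l2 -> x ^+ l1 = y ^+ l2 -> (l2 * i + l1 * j = g.*2)%N ->
  0 <= x ^+ i * y ^+ j.
Proof.
move=> hco xy eq_g.
have [odd1|even1] := boolP (odd l1).
  rewrite -(exprn_odd_ge0 _ odd1) exprMn -exprM mulnC exprM xy -!exprM -exprD.
  by rewrite (mulnC j) eq_g exprn_even_ge0 // odd_double.
have odd2 : odd l2.
  move: hco; rewrite -(even_halfK even1) -muln2 coprimeMl coprime2n => /andP[_].
  by [].
rewrite -(exprn_odd_ge0 _ odd2) exprMn -!exprM (mulnC j) (exprM y) -xy -exprM.
by rewrite -exprD (mulnC i) eq_g exprn_even_ge0 // odd_double.
Qed.

Lemma representing_measure_ge0 (R : realType) (n : nat) (K : set (R * R))
    (beta : truncated_seq R n) (m : monomials (2 * n)) :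
  has_representing_measure K beta ->
  (forall z, K z -> 0 <= z.1 ^+ m ord0 * z.2 ^+ m ord_max) ->
  0 <= beta m.
Proof.
move=> [mu [[N [mN muN0 KN]] /(_ m) /= [fint feq]]] f_ge0.
rewrite -lee_fin -feq (negligible_integral mN _ fint muN0) //.
apply: integral_ge0 => z [_ Nz]; rewrite lee_fin f_ge0 //.
by apply: contrapT => /KN.
Qed.

Theorem theorem3p1 (R : realType) (l1 l2 : nat)
    (hl1 : (1 < l1)%N) (hl2 : (1 < l2)%N) (hco : coprime l1 l2) :
  let p : mpoly 2 R := coordX R ^+ l1 - coordY R ^+ l2 in
  forall n : nat, (maxn l1 l2 <= n)%N ->
    (exists beta : truncated_seq R n,
        (forall k : nat, (0 < k)%N ->
           extension_property k beta [:: 1; p; - p]) /\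
        ~ has_representing_measure (zero_set p) beta) /\
    (forall k : nat, ~ property_S n k [:: 1; p; - p]).
Proof.
move=> p n le_n.
pose g := (l1 * l2 - l1 - l2)%N.
pose beta := weight_seq R l1 l2 (punctured R g) n.
have ext k : extension_property k beta [:: 1; p; - p].
  apply: extension_property_weight_seq; rewrite ?(ltnW hl1) ?(ltnW hl2) //.
  move=> I f v.
  apply: (punctured_graded_form_ge0 R g I (fun i => weight l1 l2 (f i))) => i.
  exact: weight_neq_frobenius.
have no_measure : ~ has_representing_measure (zero_set p) beta.
  pose m : multinom 2 := mnm_add (mnm_muln (mnm1 ord0) (l1 - 2))
    (mnm_muln (mnm1 ord_max) (l2 - 2)).
  have deg_m : (mdeg m < (2 * n).+1)%N.
    by rewrite mdegD !mdegMn !mdeg1 !mul1n; lia.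
  have mE : (m ord0 = l1 - 2)%N /\ (m ord_max = l2 - 2)%N.
    by rewrite !mnmDE !mulmnE !mnm1E /=; lia.
  have wm : (l2 * (l1 - 2) + l1 * (l2 - 2) = g.*2)%N by rewrite /g; nia.
  move=> hmu.
  have := @representing_measure_ge0 _ _ _ _ (BMultinom deg_m) hmu.
  rewrite /beta /weight_seq /weight /= mE.1 mE.2 wm /punctured eqxx.
  rewrite leNgt ltrN10 => /(_ _)/notF; apply => z /zero_set_binomial_curve xy.
  exact: (@monomial_ge0_on_curve _ l1 l2 g).
split; first by exists beta; split.
by move=> k /(_ beta)[_ /(_ (ext k))]; rewrite semialgebraic_pm.
Qed.
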